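(* Let $\Pi$ be a distribution over matrices $S\in\mathbb{R}^{r\times n}$. Let $k\geq 1$, let $\gamma\in(0,\frac12)$ be a constant, let $c_1,c_2>0$ be arbitrary constants, and suppose $\min(n,d)\geq\Omega(k^{c_2})$. If for all $A\in\mathbb{R}^{n\times d}$, $$\Pr_{S\sim\Pi}[\mathcal{M}(A,S,k,\gamma)\text{ succeeds}]\geq\Omega(1/k^{c_1}),$$ then $r$ must be at least $\Omega(k^{c_2-2c_1-2})$.
   Context: Given $A\in\mathbb{R}^{n\times d}$, $S\in\mathbb{R}^{r\times n}$, $k\geq1$ and $\gamma\in(0,\frac12)$, an algorithm $\mathcal{M}(A,S,k,\gamma)$ outputs a matrix $B\in\mathbb{R}^{n\times r}$, and it is said to succeed if $\|BSA-A\|_1\leq k^\gamma\cdot\min_{\mathrm{rank}\text{-}k\ A'}\|A'-A\|_1$, where $\|M\|_1=\sum_{i,j}|M_{i,j}|$ is the entrywise $\ell_1$ norm and the minimum is over all $n\times d$ matrices of rank at most $k$. *)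

(* Defs.v *)
From HB Require Import structures.
From mathcomp Require Import all_boot all_order all_algebra.
From mathcomp Require Import all_classical all_reals all_analysis.

Set Implicit Arguments.
Unset Strict Implicit.
Unset Printing Implicit Defensive.

Import Order.TTheory GRing.Theory Num.Theory.
Import numFieldNormedType.Exports.

Local Open Scope classical_set_scope.
Local Open Scope ring_scope.

(* Entrywise norm, not the operator norm induced by l1. *)
Definition l1norm (R : realType) (m n : nat) (A : 'M[R]_(m, n)) : R :=
  \sum_(i < m) \sum_(j < n) `|A i j|.

(* The infimum is over a nonempty set (A' = 0) bounded below by 0, and it is
   attained because the matrices of rank at most k form a closed set; hence it
   is the minimum. *)
Definition lowrank_opt (R : realType) (n d k : nat) (A : 'M[R]_(n, d)) : R :=
  inf [set l1norm (A' - A) | A' in [set A' : 'M[R]_(n, d) | (\rank A' <= k)%N]].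

(* The algorithm receives A, S, k and gamma, in this order. *)
Definition algorithm (R : realType) (n d r : nat) : Type :=
  'M[R]_(n, d) -> 'M[R]_(r, n) -> nat -> R -> 'M[R]_(n, r).

Definition succeeds (R : realType) (n d r : nat) (M : algorithm R n d r)
    (A : 'M[R]_(n, d)) (S : 'M[R]_(r, n)) (k : nat) (gamma : R) : Prop :=
  l1norm (M A S k gamma *m S *m A - A) <= k%:R `^ gamma * lowrank_opt k A.

(* 'M[R]_(m, n) with its Borel sigma-algebra, for the product topology of
   R^(m * n). *)
Definition borel_mx (R : realType) (m n : nat) :=
  g_sigma_algebraType [set U : set 'M[R]_(m, n) | open U].

(* Main.v *)
Require Import Defs.
From HB Require Import structures.
From mathcomp Require Import all_boot all_order all_algebra all_field.
From mathcomp Require Import all_classical all_reals all_analysis.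
From mathcomp Require Import ring lra.

(** The bound already holds for every single sketch [S] that succeeds on one
    well-chosen [A].

    Take [A = [U, I]] (padded with zeros), where the rows of [U] are the 0/1
    indicator vectors of the graphs of polynomials of bounded degree over a
    field with [q ~ sqrt k] elements: they have squared norm [q], pairwise inner
    products [O(1)], and [U] has at most [k] columns, so the optimal rank-[k]
    error is at most the number [m] of rows. Success forces [P = B S], a matrix
    of rank at most [r], to satisfy [P U ~ U] and to have l1 norm
    [O(k^gamma m)]. The off-diagonal part of [P] then contributes only
    [O(k^gamma m)] to [tr (U^T P U) ~ q m], which is negligible as
    [gamma < 1/2], so the trace of [P] (after
    discarding the few rows of large l1 norm) is of order [m]. But the trace of a
    matrix of rank [r] is at most [r] times its largest row l1 norm, whence
    [r] is at least of order [m / k^gamma]. *)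

Set Implicit Arguments.
Unset Strict Implicit.
Unset Printing Implicit Defensive.

Import Order.TTheory GRing.Theory Num.Theory.
Import numFieldNormedType.Exports.

Local Open Scope classical_set_scope.
Local Open Scope ring_scope.

(** * Trace of a matrix of bounded rank *)

(** Makes a single coefficient a determinant: exchanging one chosen row for another turns the
    identity block of the coefficient matrix into such an [M]. *)
Lemma det_row_replace1 (F : comNzRingType) (p : nat) (M : 'M[F]_p) (s : 'I_p) :
  (forall t u, t != s -> M t u = (t == u)%:R) -> \det M = M s s.
Proof.
move=> MI; rewrite (expand_det_col M s) (bigD1 s) //= big1 ?addr0; last first.
  by move=> t ts; rewrite MI // (negPf ts) mul0r.
rewrite /cofactor addnn -mul2n exprM sqrrN !expr1n mul1r.
suff -> : row' s (col' s M) = 1%:M by rewrite det1 mulr1.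
apply/matrixP => t u; rewrite !mxE MI ?(inj_eq lift_inj) //.
by rewrite eq_sym neq_lift.
Qed.

(* The rows are those of a p x p minor of maximal absolute determinant; the
   bound on the coefficients is Cramer's rule. *)
Lemma bounded_row_spanning (R : realFieldType) (g p : nat) (X : 'M[R]_(g, p)) :
  row_full X -> exists (f : 'I_g ^ p) (C : 'M[R]_(g, p)),
    X = C *m rowsub f X /\ forall i s, `|C i s| <= 1.
Proof.
move=> Xfull.
case: (@Order.TotalTheory.arg_maxP _ _ _ (fullrankfun Xfull) predT
  (fun f : 'I_g ^ p => `|\det (rowsub f X)|) isT) => f _ fmax.
have det_gt0 : 0 < `|\det (rowsub f X)|.
  apply: lt_le_trans (fmax (fullrankfun Xfull) isT).
  by rewrite normr_gt0 -unitfE -unitmxE fullrowsub_unit.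
have Xf_unit : rowsub f X \in unitmx by rewrite unitmxE unitfE -normr_gt0.
pose C := X *m invmx (rowsub f X).
have XE : X = C *m rowsub f X by rewrite mulmxKV.
exists f, C; split=> // i s.
pose f' : 'I_g ^ p := [ffun t => if t == s then i else f t].
have XE' : rowsub f' X = rowsub f' C *m rowsub f X.
  by rewrite {1}XE -mul_rowsub_mx.
have CI : rowsub f C = 1%:M by rewrite -mul_rowsub_mx mulmxV.
have detC : \det (rowsub f' C) = C i s.
  rewrite (@det_row_replace1 _ _ _ s); first by rewrite mxE ffunE eqxx.
  move=> t u ts; rewrite mxE ffunE (negPf ts).
  by move/matrixP: CI => /(_ t u); rewrite !mxE.
have /= := fmax f' isT.
by rewrite XE' det_mulmx normrM detC ger_pMl.
Qed.

(** All rows of [P] are combinations of [\rank P] of its rows with coefficients in [-1, 1].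
    Regrouping the trace by these chosen rows, each contributes at most its l1 norm. *)
Lemma trace_le_rank_row_norm (R : realFieldType) (g : nat) (P : 'M[R]_g)
    (tau : R) : (forall i, \sum_j `|P i j| <= tau) ->
  \tr P <= (\rank P)%:R * tau.
Proof.
move=> Ptau.
have [f [C [XE C1]]] := bounded_row_spanning (col_base_full P).
have PE : P = C *m rowsub f P.
  by rewrite -{1}(mulmx_base P) {1}XE -mulmxA mul_rowsub_mx mulmx_base.
rewrite {1}/mxtrace.
have -> : \sum_i P i i = \sum_s \sum_i C i s * P (f s) i.
  rewrite exchange_big; apply: eq_bigr => i _.
  by rewrite {1}PE mxE; apply: eq_bigr => s _; rewrite mxE.
apply: (@le_trans _ _ (\sum_(s < \rank P) tau)); last first.
  by rewrite sumr_const card_ord mulr_natl.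
apply: ler_sum => s _; apply: le_trans (Ptau (f s)).
apply: ler_sum => i _; apply: le_trans (ler_norm _) _.
by rewrite normrM ler_piMl.
Qed.

(** * Nearly orthogonal 0/1 vectors from polynomials *)

(** Columns are the points of the plane over the field with [2 ^ t] elements. There are
    [(2 ^ t) ^ D] polynomials of degree less than [D], and two distinct ones agree at fewer than [D]
    points. *)
Lemma reed_solomon (R : realType) (t D m : nat) :
  (0 < t)%N -> (m <= (2 ^ t) ^ D)%N ->
  exists U : 'M[R]_(m, (2 ^ t) * (2 ^ t)),
   [/\ forall i c, `|U i c| <= 1,
       forall i, \sum_c U i c * U i c = (2 ^ t)%:R
     & forall i j, i != j -> `|\sum_c U j c * U i c| <= D%:R].
Proof.
move=> t0 mD.
have [F _ cardF] := pPrimePowerField (isT : prime 2) t0.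
rewrite -cardF in mD *.
have mD' : (m <= #|{: 'rV[F]_D}|)%N by rewrite card_mx mul1n.
pose w (i : 'I_m) : 'rV[F]_D := enum_val (widen_ord mD' i).
have w_inj : injective w.
  by move=> i j /enum_val_inj /(congr1 val) /= ij; apply: val_inj.
have cardFF : (#|F| * #|F| = #|{: F * F}|)%N by rewrite card_prod.
rewrite cardFF.
pose h (i : 'I_m) (z : F * F) : R := ((rVpoly (w i)).[z.1] == z.2)%:R.
(* Two graphs share one point for each abscissa where the polynomials agree. *)
have hh i j : \sum_(c < #|{: F * F}|) h i (enum_val c) * h j (enum_val c) =
    #|[pred x : F | (rVpoly (w i)).[x] == (rVpoly (w j)).[x]]|%:R.
  transitivity (\sum_(z in {: F * F}) h i z * h j z).
    by rewrite (big_enum_val (fun z : F * F => h i z * h j z)).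
  transitivity (\sum_x \sum_y h i (x, y) * h j (x, y)).
    by rewrite pair_bigA; apply: eq_big => [|[]].
  rewrite -sum1_card natr_sum [RHS]big_mkcond /=; apply: eq_bigr => x _.
  rewrite (bigD1 (rVpoly (w i)).[x]) //= big1 ?addr0 => [|y yN].
    by rewrite /h /= eqxx mul1r inE eq_sym; case: ifP.
  by rewrite /h /= eq_sym (negPf yN) mul0r.
exists (\matrix_(i, c) h i (enum_val c)); split.
- by move=> i c; rewrite mxE /h normr_nat; case: eqP => _; rewrite ?ler01.
- move=> i; under eq_bigr do rewrite !mxE.
  by rewrite hh; congr (_%:R); apply: eq_card => x; rewrite !inE eqxx.
- move=> i j ij; under eq_bigr do rewrite !mxE.
  rewrite hh normr_nat ler_nat.
  pose p := rVpoly (w j) - rVpoly (w i).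
  have p0 : p != 0.
    rewrite subr_eq0; apply: contra ij => /eqP /(can_inj rVpolyK) /w_inj ->.
    exact: eqxx.
  rewrite cardE; set s := enum _.
  have : (size s < size p)%N.
    apply: max_poly_roots => //; last exact: enum_uniq.
    by apply/allP => x; rewrite mem_enum inE /root !hornerE subr_eq0.
  move/ltnW/leq_trans; apply.
  apply: leq_trans (size_polyD _ _) _.
  by rewrite size_polyN geq_max !size_poly.
Qed.

(** * Entrywise l1 norm and the low-rank optimum *)

Lemma l1norm_ge0 (R : realType) (m n : nat) (A : 'M[R]_(m, n)) : 0 <= l1norm A.
Proof. by apply: sumr_ge0 => i _; apply: sumr_ge0. Qed.

Lemma l1norm_eq0 (R : realType) (m n : nat) (A : 'M[R]_(m, n)) :
  l1norm A = 0 -> A = 0.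
Proof.
move=> A0; apply/matrixP => i j; rewrite mxE; apply/eqP; rewrite -normr_eq0.
apply/eqP; move: A0; rewrite /l1norm => /psumr_eq0P rows0.
by move: j (isT : xpredT j); apply: psumr_eq0P => //; apply: rows0 => // l _;
  apply: sumr_ge0.
Qed.

Lemma l1norm0 (R : realType) (m n : nat) : l1norm (0 : 'M[R]_(m, n)) = 0.
Proof.
by rewrite /l1norm big1 // => i _; rewrite big1 // => j _; rewrite mxE normr0.
Qed.

Lemma l1normN (R : realType) (m n : nat) (A : 'M[R]_(m, n)) :
  l1norm (- A) = l1norm A.
Proof. by apply: eq_bigr => i _; apply: eq_bigr => j _; rewrite mxE normrN. Qed.

Lemma l1norm_le_add (R : realType) (m n : nat) (A B : 'M[R]_(m, n)) :
  l1norm (A + B) <= l1norm A + l1norm B.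
Proof.
rewrite -big_split /=; apply: ler_sum => i _; rewrite -big_split /=.
by apply: ler_sum => j _; rewrite mxE ler_normD.
Qed.

Lemma l1norm1 (R : realType) (m : nat) : l1norm (1%:M : 'M[R]_m) = m%:R.
Proof.
rewrite /l1norm -[in RHS](card_ord m) -sumr_const; apply: eq_bigr => i _.
rewrite (bigD1 i) //= big1 ?addr0 => [|j ji]; rewrite mxE ?eqxx ?normr1 //.
by rewrite eq_sym (negPf ji) normr0.
Qed.

Lemma l1norm_row_mx (R : realType) (m n1 n2 : nat) (A : 'M[R]_(m, n1))
    (B : 'M[R]_(m, n2)) : l1norm (row_mx A B) = l1norm A + l1norm B.
Proof.
rewrite -big_split /=; apply: eq_bigr => i _; rewrite big_split_ord /=.
by congr (_ + _); apply: eq_bigr => j _; rewrite (row_mxEl, row_mxEr).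
Qed.

Lemma l1norm_col_mx (R : realType) (m1 m2 n : nat) (A : 'M[R]_(m1, n))
    (B : 'M[R]_(m2, n)) : l1norm (col_mx A B) = l1norm A + l1norm B.
Proof.
rewrite /l1norm big_split_ord /=.
by congr (_ + _); apply: eq_bigr => i _; apply: eq_bigr => j _;
  rewrite (col_mxEu, col_mxEd).
Qed.

Lemma lowrank_opt_le (R : realType) (n d k : nat) (A A' : 'M[R]_(n, d)) :
  (\rank A' <= k)%N -> lowrank_opt k A <= l1norm (A' - A).
Proof.
move=> rkA'; apply: ge_inf; last by exists A'.
by exists 0 => _ [X _ <-]; apply: l1norm_ge0.
Qed.

(** * A hard matrix for one fixed sketch *)

(* Summing [<u_i, (P U)_i>] over the rows [i] of [P] of small l1 norm gives
   about [q] per row. Off-diagonal entries of [P] contribute little because the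
   rows of [U] are nearly orthogonal, and diagonal entries contribute little
   because of [trace_le_rank_row_norm]; hence [r] is large. *)
Lemma rank_of_approx_fixing (R : realType) (m s r : nat) (U : 'M[R]_(m, s))
    (B : 'M[R]_(m, r)) (S : 'M[R]_(r, m)) (q D kappa : R) :
  0 <= q -> 0 <= D -> 1 <= kappa ->
  (forall i c, `|U i c| <= 1) ->
  (forall i, \sum_c U i c * U i c = q) ->
  (forall i j, i != j -> `|\sum_c U j c * U i c| <= D) ->
  l1norm (B *m S *m U - U) + l1norm (B *m S - 1%:M) <= kappa * m%:R ->
  q * m%:R / 2 <= kappa * m%:R * (1 + 2 * D) + 4 * q * kappa * r%:R.
Proof.
move=> q0 D0 kappa1 U1 Uq UD; set P := B *m S; set E := P *m U - U => hyp.
pose rho i : R := \sum_j `|P i j|.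
have rho0 i : 0 <= rho i by apply: sumr_ge0.
have Prho : \sum_i rho i <= 2 * kappa * m%:R.
  have := l1norm_le_add (P - 1%:M) 1%:M.
  rewrite subrK l1norm1 {1}/l1norm -/(\sum_i rho i) => le1.
  have := l1norm_ge0 E; have := ler0n R m; nra.
pose G i : R := ((rho i <= 4 * kappa)%R : nat)%:R.
have G0 i : 0 <= G i by apply: ler0n.
have G1 i : G i <= 1 by rewrite /G lern1 leq_b1.
(* Markov's inequality: the row norms sum to at most [2 * kappa * m], so at most half of the rows
   exceed [4 * kappa]. *)
have sumG : m%:R / 2 <= \sum_i G i.
  have : \sum_i (1 - G i) * (4 * kappa) <= \sum_i rho i.
    apply: ler_sum => i _; rewrite /G; case: (leP (rho i) (4 * kappa)) => [_|/ltW] /=.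
      by rewrite subrr mul0r.
    by rewrite subr0 mul1r.
  rewrite -mulr_suml sumrB sumr_const card_ord => le1; nra.
pose PG : 'M[R]_m := \matrix_(i, j) (G i * P i j).
have trPG : \sum_i G i * P i i <= r%:R * (4 * kappa).
  have -> : \sum_i G i * P i i = \tr PG by apply: eq_bigr => i _; rewrite [RHS]mxE.
  apply: le_trans (trace_le_rank_row_norm (_ : forall i, _ <= 4 * kappa)) _.
    move=> i; rewrite (eq_bigr (fun j => G i * `|P i j|)); last first.
      by move=> j _; rewrite [PG i j]mxE normrM ger0_norm.
    rewrite -mulr_sumr -/(rho i) /G; case: (leP (rho i) (4 * kappa)) => /= [le1|_].
      by rewrite mul1r.
    by rewrite mul0r; lra.
  apply: ler_wpM2r; first by lra.
  rewrite ler_nat.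
  have -> : PG = diag_mx (\row_i G i) *m B *m S.
    rewrite -mulmxA -/P; apply/matrixP => i j.
    by rewrite mul_diag_mx [LHS]mxE [RHS]mxE [(\row__ _) _ _]mxE.
  by apply: leq_trans (mxrankM_maxl _ _) (rank_leq_col _).
have row_le i : G i * q <=
    \sum_c `|E i c| + q * (G i * P i i) + D * rho i.
  (* Write [u_i = (P U)_i - E_i], take the inner product with [u_i], and split off the diagonal term
     of [P U]. *)
  have qE : q = - (\sum_c E i c * U i c) +
      (q * P i i + \sum_(j | j != i) P i j * \sum_c U j c * U i c).
    have <- : \sum_j P i j * (\sum_c U j c * U i c) =
        q * P i i + \sum_(j | j != i) P i j * \sum_c U j c * U i c.
      by rewrite (bigD1 i) //= Uq [_ * q]mulrC.
    have -> : \sum_j P i j * (\sum_c U j c * U i c) =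
        \sum_c (P *m U) i c * U i c.
      under eq_bigr do rewrite mulr_sumr.
      rewrite exchange_big; apply: eq_bigr => c _; rewrite mxE mulr_suml.
      by apply: eq_bigr => j _; rewrite mulrA.
    rewrite addrC -sumrB -{1}(Uq i); apply: eq_bigr => c _.
    by rewrite /E [(_ - U) i c]mxE [(- U) i c]mxE; ring.
  have le1 : - (\sum_c E i c * U i c) <= \sum_c `|E i c|.
    rewrite -sumrN; apply: ler_sum => c _; apply: le_trans (ler_norm _) _.
    by rewrite normrN normrM ler_piMr.
  have le2 : \sum_(j | j != i) P i j * (\sum_c U j c * U i c) <= D * rho i.
    apply: (@le_trans _ _ (\sum_(j | j != i) D * `|P i j|)).
      apply: ler_sum => j ji; apply: le_trans (ler_norm _) _.
      by rewrite normrM mulrC ler_wpM2r // UD // eq_sym.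
    rewrite -mulr_sumr; apply: ler_wpM2l => //.
    by rewrite /rho [leRHS](bigD1 i) //= lerDr.
  have E0 : 0 <= \sum_c `|E i c| by apply: sumr_ge0.
  have Drho : 0 <= D * rho i by apply: mulr_ge0.
  rewrite {1}qE; move: (G0 i) (G1 i) le1 le2 E0 Drho.
  set x := \sum_c E i c * U i c; set y := \sum_(j | _) _; nra.
have : \sum_i G i * q <=
    \sum_i (\sum_c `|E i c| + q * (G i * P i i) + D * rho i).
  by apply: ler_sum => i _; exact: row_le.
rewrite !big_split /= -mulr_suml -!mulr_sumr.
rewrite -/(l1norm E) => total.
have := l1norm_ge0 (P - 1%:M) => ?.
have h1 : q * \sum_i G i * P i i <= q * (r%:R * (4 * kappa)) by apply: ler_wpM2l.
have h2 : D * \sum_i rho i <= D * (2 * kappa * m%:R) by apply: ler_wpM2l.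
have h3 : m%:R / 2 * q <= (\sum_i G i) * q by apply: ler_wpM2r.
move: total h1 h2 h3 hyp; nra.
Qed.

(** Erasing the identity block of [A] leaves rank at most [s <= k] at cost [m], which bounds the
    optimum. Only the top rows of [B] and the left columns of [S] reach the nonzero blocks of
    [B S A - A] kept here: the [U] block gives [P U - U], the identity block gives [P - 1]. *)
Lemma hard_instance (R : realType) (n d r k m s : nat) (U : 'M[R]_(m, s))
    (q D kappa : R) :
  0 <= q -> 0 <= D -> 1 <= kappa ->
  (forall i c, `|U i c| <= 1) ->
  (forall i, \sum_c U i c * U i c = q) ->
  (forall i j, i != j -> `|\sum_c U j c * U i c| <= D) ->
  (s <= k)%N -> (m <= n)%N -> (s + m <= d)%N ->
  exists A : 'M[R]_(n, d), forall (B : 'M[R]_(n, r)) (S : 'M[R]_(r, n)),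
    l1norm (B *m S *m A - A) <= kappa * lowrank_opt k A ->
    q * m%:R / 2 <= kappa * m%:R * (1 + 2 * D) + 4 * q * kappa * r%:R.
Proof.
move=> q0 D0 kappa1 U1 Uq UD sk /subnKC <- /subnKC <-.
set n' := (n - m)%N; set d' := (d - (s + m))%N.
pose A : 'M[R]_(m + n', (s + m) + d') :=
  col_mx (row_mx (row_mx U 1%:M) 0) 0.
have optA : lowrank_opt k A <= m%:R.
  pose A' : 'M[R]_(m + n', (s + m) + d') := col_mx (row_mx (row_mx U 0) 0) 0.
  have A'E : A' = col_mx U 0 *m row_mx (row_mx 1%:M 0) 0.
    by rewrite mul_col_mx mul0mx !mul_mx_row mulmx1 !mulmx0.
  have /(lowrank_opt_le A) : (\rank A' <= k)%N.
    rewrite A'E; apply: leq_trans (mxrankM_maxl _ _) _.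
    exact: leq_trans (rank_leq_col _) sk.
  rewrite /A' /A opp_col_mx !opp_row_mx add_col_mx !add_row_mx.
  rewrite l1norm_col_mx !l1norm_row_mx !subrr !l1norm0 sub0r l1normN l1norm1.
  by rewrite !addr0 add0r.
exists A => B S hyp.
have {}hyp : l1norm (B *m S *m A - A) <= kappa * m%:R.
  by apply: le_trans hyp _; apply: ler_wpM2l => //; lra.
move: hyp; rewrite -[B]vsubmxK -[S]hsubmxK.
move: (usubmx B) (dsubmx B) (lsubmx S) (rsubmx S) => B1 B2 S1 S2.
rewrite -mulmxA /A mul_row_col mulmx0 addr0 mul_col_mx !mul_mx_row.
rewrite opp_col_mx !opp_row_mx add_col_mx !add_row_mx.
rewrite l1norm_col_mx !l1norm_row_mx mulmx1 => hyp.
apply: (@rank_of_approx_fixing _ _ _ _ U B1 S1) => //.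
move: hyp; rewrite mulmxA.
set x := l1norm (_ - U); set y := l1norm (_ - 1%:M).
set z := l1norm _; set w := l1norm _.
have z0 : 0 <= z by apply: l1norm_ge0.
have w0 : 0 <= w by apply: l1norm_ge0.
lra.
Qed.

(** * Choice of parameters and dependence on [k] *)

(** A matrix of rank one has optimum 0, so success means exact recovery, while [r = 0] would make
    [B S A] vanish. This settles the values of [k] below the threshold. *)
Lemma sketch_dim_gt0 (R : realType) (n d r k : nat) (kappa : R) :
  (0 < n)%N -> (0 < d)%N -> (0 < k)%N ->
  exists A : 'M[R]_(n, d), forall (B : 'M[R]_(n, r)) (S : 'M[R]_(r, n)),
    0 <= kappa -> l1norm (B *m S *m A - A) <= kappa * lowrank_opt k A ->
    (0 < r)%N.
Proof.
case: n d => [//|n] [//|d] _ _ k0.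
pose A : 'M[R]_(n.+1, d.+1) := delta_mx ord0 ord0.
exists A => B S kappa0; case: r B S => // B S.
have opt0 : lowrank_opt k A <= 0.
  rewrite -(l1norm0 R n.+1 d.+1) -(subrr A); apply: lowrank_opt_le.
  by rewrite mxrank_delta.
rewrite (flatmx0 S) mulmx0 mul0mx sub0r l1normN => hyp.
have : l1norm A = 0.
  apply/le_anti; rewrite l1norm_ge0 andbT; apply: le_trans hyp _.
  exact: mulr_ge0_le0.
move/l1norm_eq0/matrixP => /(_ ord0 ord0); rewrite !mxE eqxx /= => /eqP.
by rewrite oner_eq0.
Qed.

Lemma powR_ge1 (R : realType) (x p : R) : 1 <= x -> 0 <= p -> 1 <= x `^ p.
Proof. by move=> x1 p0; rewrite -(powRr0 x) ler_powR. Qed.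

Lemma sketch_dim_large (R : realType) (gamma c2 a : R) :
  0 < gamma -> gamma < 1 / 2 -> 2 < c2 -> 0 < a ->
  exists2 K : R, 0 < K &
    forall (k n d r : nat) (M : algorithm R n d r),
      K <= k%:R -> a * k%:R `^ c2 <= (minn n d)%:R ->
      (forall A : 'M[R]_(n, d), exists S, succeeds M A S k gamma) ->
      a / 64 * k%:R `^ (c2 - 1) <= r%:R.
Proof.
move=> gamma0 gamma_lt c2_gt2 a0.
pose N := (Num.truncn (c2 + 1)).+1.
have N_gt : c2 + 1 <= N%:R by apply/ltW; rewrite truncnS_gt.
pose delta := 1 / 2 - gamma.
have delta0 : 0 < delta by rewrite subr_gt0.
(* With [D = 2 * N], this is [8 * (1 + 2 * D)]; once [W <= k ^ delta], the off-diagonal term is at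
   most half of the left-hand side of [hard_instance]. *)
pose W : R := 8 * (1 + 2 * (2 * N)%:R).
have W0 : 0 < W by rewrite mulr_gt0 // ltr_pwDl // mulr_ge0.
have Wd0 : 0 <= W `^ delta^-1 by apply: powR_ge0.
have a40 : 0 <= a * 4 ^+ N by rewrite mulr_ge0 // ?ltW // exprn_gt0.
have ai0 : 0 < 4 / a by rewrite divr_gt0.
(* In order, the summands ensure [t > 0], [k <= z], enough polynomials for [m] rows, and
   [W <= k ^ delta]. *)
exists (4 + 4 / a + a * 4 ^+ N + W `^ delta^-1); first lra.
move=> k n d r M; set x : R := k%:R => Kx ynd succ.
have x4 : 4 <= x by lra.
have x1 : 1 <= x by lra.
have x0 : 0 < x by lra.
have ax : 4 <= a * x by rewrite mulrC -ler_pdivrMr //; lra.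
have k4 : (4 <= k)%N by rewrite -(ler_nat R).
set y := x `^ c2 in ynd.
have y_ge : x ^+ 2 <= y by rewrite -powR_mulrn ?(ltW x0) // ler_powR // ltW.
(* Half of the available dimension goes to the identity block; since [x <= z], the other half has
   room for the [q * q] columns of [U]. *)
pose z := a * y / 2.
have z_ge : x <= z.
  have : a * x ^+ 2 <= a * y by apply: ler_wpM2l => //; apply: ltW.
  rewrite /z; nra.
have z0 : 0 <= z by lra.
pose m := Num.truncn z.
have m_le : m%:R <= z by rewrite truncn_le.
have m_gt : z < m%:R + 1 by rewrite natr1 truncnS_gt.
(* The largest power of two [q] with [q * q <= k]; hence [k < 4 * q * q]. *)
pose t := trunc_log 4 k.
have /andP[t_le t_gt] : (4 ^ t <= k < 4 ^ t.+1)%N.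
  by apply: trunc_log_bounds => //; apply: leq_trans k4.
have t0 : (0 < t)%N.
  by rewrite lt0n; apply: contraTneq t_gt => ->; rewrite -leqNgt.
have qqE : (2 ^ t * 2 ^ t = 4 ^ t)%N by rewrite -expnMn.
set q := (2 ^ t)%N in qqE.
have q0 : 0 < q%:R :> R by rewrite ltr0n expn_gt0.
have qq_ge : x <= 4 * (q%:R * q%:R).
  by rewrite -natrM -natrM ler_nat qqE -expnS ltnW.
have qq_le : (q * q <= k)%N by rewrite qqE.
have m_card : (m <= q ^ (2 * N))%N.
  rewrite -(ler_nat R); apply: le_trans m_le _.
  apply: (@le_trans _ _ ((x / 4) ^+ N)); last first.
    rewrite expnM natrX; apply: lerXn2r; rewrite ?nnegrE ?ler0n ?divr_ge0 //.
    by rewrite -mulnn natrM; lra.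
  rewrite expr_div_n ler_pdivlMr ?exprn_gt0 //.
  apply: (@le_trans _ _ (y * x)); last first.
    rewrite /y -{2}(powRr1 (ltW x0)) -powRD; last by rewrite (gt_eqF x0) implybT.
    by rewrite -powR_mulrn ?(ltW x0) // ler_powR.
  have y0 : 0 <= y by apply: powR_ge0.
  have : y * (a * 4 ^+ N) <= y * x by apply: ler_wpM2l => //; lra.
  have : 0 <= y * (a * 4 ^+ N) by apply: mulr_ge0.
  by rewrite /z; set u := 4 ^+ N; lra.
have [U [U1 Uq UD]] := reed_solomon R t0 m_card.
have nat_mn : (q * q + m <= minn n d)%N.
  rewrite -(ler_nat R); apply: le_trans ynd; rewrite natrD.
  have : (q * q)%:R <= x by rewrite ler_nat.
  by rewrite /z in z_ge m_le; lra.
have mn : (m <= n)%N.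
  by apply: leq_trans (leq_trans (leq_addl _ _) nat_mn) (geq_minl _ _).
have qmd : (q * q + m <= d)%N by apply: leq_trans nat_mn (geq_minr _ _).
pose kappa := x `^ gamma.
have kappa1 : 1 <= kappa by apply: powR_ge1; rewrite // ltW.
have kappa_x : kappa <= x.
  by rewrite -[leRHS]powRr1 ?(ltW x0) // ler_powR //; lra.
have [A hA] := hard_instance r (ltW q0) (ler0n _ (2 * N)) kappa1 U1 Uq UD
  qq_le mn qmd.
have [S /hA bound] := succ A.
have W_le : W <= x `^ delta.
  rewrite -[W]powRr1 ?(ltW W0) // -(@mulVf _ delta) ?gt_eqF // powRrM.
  by apply: ge0_ler_powR; rewrite ?nnegrE ?(ltW delta0) ?(ltW x0) //; lra.
(* As [gamma + delta = 1 / 2], the product [kappa * x ^ delta] is the square root of [k], which is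
   at most [2 * q]. *)
have sqrt_x : kappa * x `^ delta * (kappa * x `^ delta) = x.
  have powM u v : x `^ u * x `^ v = x `^ (u + v).
    by rewrite powRD // (gt_eqF x0) implybT.
  by rewrite !powM -[RHS]powRr1 ?(ltW x0) //; congr (_ `^ _); rewrite /delta; lra.
have kappa_q : kappa * (1 + 2 * (2 * N)%:R) <= q%:R / 4.
  have hW : kappa * W <= kappa * x `^ delta by apply: ler_wpM2l => //; lra.
  have hq : kappa * x `^ delta <= 2 * q%:R.
    have h0 : 0 <= kappa * x `^ delta by apply: mulr_ge0; apply: powR_ge0.
    by rewrite -ler_sqr ?nnegrE // ?mulr_ge0 // !expr2 sqrt_x; lra.
  by rewrite /W in hW; lra.
(* The off-diagonal term is at most [q * m / 4] and is absorbed in [q * m / 2]. *)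
have main : m%:R <= 16 * kappa * r%:R.
  rewrite -(ler_pM2l q0).
  have : m%:R * (kappa * (1 + 2 * (2 * N)%:R)) <= m%:R * (q%:R / 4).
    exact: ler_wpM2l.
  lra.
(* The crude bound [k ^ gamma <= k] costs one power of [k], whence the exponent [c2 - 1]. *)
have kr : kappa * r%:R <= x * r%:R by apply: ler_wpM2r.
have yE : y = x `^ (c2 - 1) * x.
  rewrite -{2}(powRr1 (ltW x0)) -powRD ?subrK //.
  by rewrite (gt_eqF x0) implybT.
rewrite -(ler_pM2r x0) -[leLHS]mulrA -yE.
by rewrite /z in m_gt z_ge; lra.
Qed.

Theorem theoremG31 (R : realType) (gamma c1 c2 a b : R)
    (hgamma0 : 0 < gamma) (hgamma : gamma < 1 / 2)
    (hc1 : 0 < c1) (hc2 : 0 < c2) (ha : 0 < a) (hb : 0 < b) :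
  exists2 C : R, 0 < C &
    forall (k n d r : nat) (Pi : probability (borel_mx R r n) R)
           (M : algorithm R n d r),
      (1 <= k)%N ->
      a * k%:R `^ c2 <= (minn n d)%:R ->
      (forall A : 'M[R]_(n, d),
         ((b / k%:R `^ c1)%:E <=
            Pi [set S : borel_mx R r n | succeeds M A S k gamma])%E) ->
      C * k%:R `^ (c2 - 2 * c1 - 2) <= r%:R.
Proof.
(* An event of positive probability is nonempty: every [A] has a sketch on which the algorithm
   succeeds. *)
have succ k n d r (Pi : probability (borel_mx R r n) R) (M : algorithm R n d r) :
    (1 <= k)%N ->
    (forall A : 'M[R]_(n, d),
       ((b / k%:R `^ c1)%:E <=
          Pi [set S : borel_mx R r n | succeeds M A S k gamma])%E) ->
    forall A : 'M[R]_(n, d), exists S, succeeds M A S k gamma.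
  move=> k1 PiM A.
  have [E0|/set0P[S hS]] :=
      eqVneq [set S : borel_mx R r n | succeeds M A S k gamma] set0; last first.
    by exists S.
  have := PiM A; rewrite E0 measure0 lee_fin leNgt.
  by rewrite divr_gt0 // powR_gt0 // ltr0n.
have r_ge1 k n d r (M : algorithm R n d r) :
    (1 <= k)%N -> a * k%:R `^ c2 <= (minn n d)%:R ->
    (forall A : 'M[R]_(n, d), exists S, succeeds M A S k gamma) ->
    1 <= r%:R :> R.
  move=> k1 and_ge MS.
  have : (0 < minn n d)%N.
    rewrite -(ltr0n R); apply: lt_le_trans and_ge.
    by rewrite mulr_gt0 // powR_gt0 // ltr0n.
  rewrite leq_min => /andP[n0 d0].
  have [A hA] := sketch_dim_gt0 r (k%:R `^ gamma) n0 d0 k1.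
  have [S hS] := MS A.
  by rewrite ler1n; apply: hA hS; apply: powR_ge0.
pose e := c2 - 2 * c1 - 2.
(* For [e <= 0] the claim follows from [k ^ e <= 1 <= r]; for [e > 0], positivity of [c1] gives
   [c2 > 2]. *)
have [e0|e0] := leP e 0.
  exists 1 => // k n d r Pi M k1 nd PiM.
  rewrite mul1r; apply: le_trans (r_ge1 _ _ _ _ M k1 nd (succ _ _ _ _ _ _ k1 PiM)).
  by rewrite -/e -[leRHS](powRr0 k%:R) ler_powR // ler1n.
have c2_gt2 : 2 < c2 by rewrite /e in e0; lra.
have [K K0 hK] := sketch_dim_large hgamma0 hgamma c2_gt2 ha.
have Ke0 : 0 < K `^ e by apply: powR_gt0.
(* The first bound serves [k >= K], where [e <= c2 - 1]; the second makes the left-hand side at most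
   1 when [k < K]. *)
exists (Num.min (a / 64) (K `^ e)^-1).
  by rewrite lt_min invr_gt0 Ke0 andbT divr_gt0.
move=> k n d r Pi M k1 nd PiM; rewrite -/e.
have MS := succ _ _ _ _ _ _ k1 PiM.
have k1' : 1 <= k%:R :> R by rewrite ler1n.
have ke0 : 0 <= (k%:R : R) `^ e by apply: powR_ge0.
have [Kk|kK] := leP K k%:R.
  apply: le_trans (hK _ _ _ _ M Kk nd MS).
  apply: ler_pM => //.
  - by rewrite le_min invr_ge0 (ltW Ke0) andbT divr_ge0 // ltW.
  - by rewrite ge_min lexx.
  - by rewrite ler_powR // /e; lra.
apply: le_trans (r_ge1 _ _ _ _ M k1 nd MS).
apply: (@le_trans _ _ ((K `^ e)^-1 * k%:R `^ e)).
  by apply: ler_wpM2r => //; rewrite ge_min lexx orbT.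
rewrite mulrC ler_pdivrMr // mul1r.
by apply: ge0_ler_powR; rewrite ?nnegrE ?ler0n ?ltW.
Qed.
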